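(* Let $\mathbf{c}=(c_n)_{n\ge1}$ be an oscillating sequence of complex numbers satisfying the growth condition $\sum_{n=1}^N|c_n|^\lambda=O(N)$ for some $\lambda>1$. Then $\mathbf{c}$ is linearly disjoint from every Feigenbaum zero topological entropy flow $\mathcal{X}=(I,T)$, $I=[-1,1]$, $T\in\mathcal{F}_\infty$.
   Context: Let $I=[-1,1]$ with the usual metric. A quadratic-like map is a $C^3$ map $T:I\to I$ such that: (1) $T(-1)=T(1)=-1$; (2) $T'(0)=0$ and $T''(0)\ne0$; (3) $T'(x)>0$ for $x\in[-1,0)$ and $T'(x)<0$ for $x\in(0,1]$; (4) the Schwarzian derivative $S(T)(x)=\frac{T'''(x)}{T'(x)}-\frac32\left(\frac{T''(x)}{T'(x)}\right)^2$ is negative for all $x\in I$, $x\neq 0$. Let $\mathcal{Q}$ be the space of all quadratic-like maps (with the $C^3$ topology), $\mathcal{Q}_0=\{T\in\mathcal{Q}: ent(T)=0\}$ and $\mathcal{Q}_+=\{T\in\mathcal{Q}: ent(T)>0\}$, where $ent$ denotes topological entropy. The space of Feigenbaum quadratic-like maps is the common boundary $\mathcal{F}_\infty=\partial\mathcal{Q}_0=\partial\mathcal{Q}_+$ in $\mathcal{Q}$. Equivalently, $\mathcal{F}_\infty$ consists of all $T\in\mathcal{Q}$ having the same kneading sequence (the sequence recording, for $n\ge1$, whether $T^n(0)$ is $<0$, $=0$ or $>0$) as the Feigenbaum quadratic polynomial $T_{t_\infty}$, where $T_t(x)=t-(1+t)x^2$ and $t_\infty$ is the limit of the increasing sequence of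 successive period-doubling parameters of the family $T_t$, $-1/2\le t\le 1$. A sequence $(c_n)_{n\ge1}$ of complex numbers is oscillating if $\lim_{N\to\infty}\frac1N\sum_{n=1}^N c_n e^{-2\pi i n t}=0$ for every $t\in[0,1)$. For a compact metric space $X$ and a continuous map $T:X\to X$, $(c_n)$ is linearly disjoint from the flow $(X,T)$ if $\lim_{N\to\infty}\frac1N\sum_{n=1}^N c_n f(T^n x)=0$ for every continuous $f:X\to\mathbb{C}$ and every $x\in X$. *)

(* Defs.v *)
From HB Require Import structures.
From mathcomp Require Import all_boot all_order all_algebra finmap.
From mathcomp Require Import complex.
From mathcomp Require Import all_classical all_reals all_analysis.

Set Implicit Arguments.
Unset Strict Implicit.
Unset Printing Implicit Defensive.

Import Order.TTheory GRing.Theory Num.Theory.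
Import numFieldNormedType.Exports.

Local Open Scope classical_set_scope.
Local Open Scope ring_scope.

Section ComplexSequences.
Context {R : realType}.

(* [R[i]] itself carries no topology in the library; its alias [R[i]^o] does,
   with the balls of the modulus. *)
Definition expi (t : R) : R[i]^o := (cos t +i* sin t)%C.

(* Complex sequences [(c_n)_(n >= 1)] are functions on [nat] whose value at 0
   is never used. *)
Implicit Types c : nat -> R[i]^o.

Definition oscillating c :=
  forall t : R, 0 <= t < 1 ->
    (fun N : nat => N%:R^-1 *
       \sum_(1 <= n < N.+1) c n * expi (- (2 * pi * n%:R * t))) @ \oo
    --> (0 : R[i]^o).

Definition growth_condition c (lambda : R) :=
  (fun N : nat => \sum_(1 <= n < N.+1) Normc.normc (c n) `^ lambda)
  =O_\oo (fun N : nat => N%:R : R).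

Definition linearly_disjoint c (X : topologicalType) (T : X -> X) :=
  forall f : X -> R[i]^o, continuous f -> forall x : X,
    (fun N : nat => N%:R^-1 * \sum_(1 <= n < N.+1) c n * f (iter n T x)) @ \oo
    --> (0 : R[i]^o).

End ComplexSequences.

Section Entropy.
Context {R : realType} {X : pseudoMetricType R}.
Implicit Types (T : X -> X) (n : nat) (e : R) (A : {fset X}).

Definition separated T n e A :=
  forall x y, x \in A -> y \in A -> x != y ->
    exists2 k, (k < n)%N & ~ ball (iter k T x) e (iter k T y).

Definition max_separated T n e : \bar R :=
  ereal_sup [set (#|` A|%:R)%:E | A in separated T n e].

(* Bowen's definition.  The growth rate is nonincreasing in [e], so its
   supremum over [e > 0] is its limit as [e] tends to [0]. *)
Definition ent T : \bar R :=
  ereal_sup [set limn_esup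
                   (fun n => (n%:R^-1)%:E * lne (max_separated T n e))%E
            | e in [set e : R | 0 < e]].

Lemma ent_ge0 T (x : X) : (0 <= ent T)%E.
Proof.
apply: le_trans (ereal_sup_ubound _); last by exists 1 => //=; exact: ltr01.
have u0 n : (0 <= (n%:R^-1)%:E * lne (max_separated T n 1))%E.
  apply: mule_ge0; first by rewrite lee_fin invr_ge0.
  have m1 : (1 <= max_separated T n 1)%E.
    apply: ereal_sup_ubound; exists [fset x]%fset; last by rewrite cardfs1.
    by move=> y z /=; rewrite !inE => /eqP -> /eqP ->; rewrite eqxx.
  rewrite -lne1 lee_lne // in_itv /= ?leey ?andbT ?lee01 //.
  exact: le_trans m1.
rewrite limn_esup_lim; apply: lime_ge; first exact: is_cvg_esups.
apply: nearW => n; apply: le_trans (u0 n) _.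
by apply: ereal_sup_ubound; exists n => /=.
Qed.

End Entropy.

Section Interval.
Variable R : realType.

(* As a type, [I11] is the subtype of [R] with the induced metric. *)
Definition I11 : set R := `[-1, 1].

Lemma I11P (x : R) : -1 <= x <= 1 -> x \in I11.
Proof. by move=> x11; rewrite inE /I11 /= in_itv. Qed.

Let ler11 : (-1 : R) <= 1. Proof. by rewrite ge0_cp. Qed.

Definition I11_m1 : I11 :=
  exist _ (-1) (I11P (introT andP (conj (lexx _) ler11))).
Definition I11_0 : I11 :=
  exist _ 0 (I11P (introT andP (conj (lerN10 R) ler01))).
Definition I11_1 : I11 :=
  exist _ 1 (I11P (introT andP (conj ler11 (lexx _)))).

Definition slope (g : I11 -> R) (x y : I11) : R :=
  (g y - g x) / (\val y - \val x).

(* The limit is taken inside the interval, so that derivatives at the end points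
   are one-sided.  [lim] has a junk value when there is no limit, which [C3]
   excludes. *)
Definition derivI (g : I11 -> R) (x : I11) : R :=
  lim (slope g x y @[y --> x^']).

Definition Dn (k : nat) (T : I11 -> I11) : I11 -> R :=
  iter k derivI (fun x => \val (T x)).

Definition C3 (T : I11 -> I11) :=
  (forall k, (k < 3)%N -> forall x, cvg (slope (Dn k T) x y @[y --> x^'])) /\
  continuous (Dn 3 T).

Definition Schwarzian (T : I11 -> I11) (x : I11) : R :=
  Dn 3 T x / Dn 1 T x - 3 / 2 * (Dn 2 T x / Dn 1 T x) ^+ 2.

Record quadratic_like (T : I11 -> I11) : Prop := QuadraticLike {
  ql_C3 : C3 T ;
  ql_ends : T I11_m1 = I11_m1 /\ T I11_1 = I11_m1 ;
  ql_crit : Dn 1 T I11_0 = 0 /\ Dn 2 T I11_0 <> 0 ;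
  ql_incr : forall x : I11, \val x < 0 -> 0 < Dn 1 T x ;
  ql_decr : forall x : I11, 0 < \val x -> Dn 1 T x < 0 ;
  ql_schwarz : forall x : I11, \val x <> 0 -> Schwarzian T x < 0
}.

Definition quad_maps : Type := set_type quadratic_like.

Definition quad_fun (T : quad_maps) : I11 -> I11 := \val T.
Coercion quad_fun : quad_maps >-> Funclass.

(* The C^3 topology is that of uniform convergence of the derivatives of orders
   0 to 3. *)
Definition jet3 (T : quad_maps) : {uniform I11 -> 'rV[R]_4} :=
  fun x => \row_(k < 4) Dn k T x.

HB.instance Definition _ := Choice.on quad_maps.
HB.instance Definition _ := Uniform.copy quad_maps (initial_topology jet3).

Definition Q0 : set quad_maps := [set T | ent T = 0%E].
Definition Qpos : set quad_maps := [set T | (0 < ent T)%E].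

Definition boundary (X : topologicalType) (A : set X) : set X :=
  closure A `\` A°.

Lemma boundaryC (X : topologicalType) (A : set X) :
  boundary (~` A) = boundary A.
Proof.
by rewrite /boundary closure_setC interiorC !setDE setCK setIC.
Qed.

Lemma QposE : Qpos = ~` Q0.
Proof.
apply/seteqP; split=> T; rewrite /Qpos /Q0 /=.
  by move=> /[swap] ->; rewrite ltxx.
by move=> /eqP e0; rewrite lt0e e0 (ent_ge0 _ I11_0).
Qed.

Lemma boundary_Qpos : boundary Qpos = boundary Q0.
Proof. by rewrite QposE boundaryC. Qed.

Definition Feigenbaum : set quad_maps := boundary Q0.

End Interval.

Arguments I11 R : clear implicits.

(* Main.v *)
Require Import Defs.
From mathcomp Require Import all_boot all_order all_algebra finmap complex.
From mathcomp Require Import all_classical all_reals all_analysis.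
From mathcomp Require Import ring lra.

(** The point is that every orbit of a Feigenbaum map is, up to an
arbitrarily small error in the mean, periodic; an oscillating sequence
averages out against periodic sequences, and the growth condition makes the
small error harmless.

No horseshoe.  If some iterate of a continuous interval map stretches each of
two disjoint intervals strictly across both, then the entropy is positive, since
all itineraries between the two intervals are realized
([horseshoe_ent_gt0]).  The strict inequalities that define such a horseshoe
involve four points only, so they persist under uniform perturbation
([horseshoe_uniformly_near]).  A map in the closure of the zero entropy maps
therefore has no horseshoe ([Feigenbaum_no_horseshoe]).

Renormalization.  Suppose that [f], the [m]-th iterate of [T], restricts to a
unimodal map of an interval [[p, q]] around the critical point [0], with [p]
fixed by [f] ([unimodal_return]).  If [f 0] does not lie across [0] from [p],
every orbit is eventually monotone under [f].  Otherwise [f] has a fixed point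
[p'] between [0] and [f 0]; let [q'] be the other preimage of [p'].  If
[f (f 0)] lies beyond [q'], then the square of [f] folds [[q', p']] across
itself and has a horseshoe.  If not, then [f \o f] restricts to a unimodal map
of [[q', p']], and every orbit either is eventually monotone under [f] or
enters [[q', p']] ([ur_step]).  Iterating, an orbit is either asymptotically
periodic or, for every [n], enters a cycle of [2 ^ n] intervals
([ur_periodic]).

Mean diameter.  Let [L] be the sum of the distances between the orbits of [p]
and of [0] over one period [m].  As [p'] lies between [0] and [f 0], and the
iterates up to [m] are monotone there, the next such sum telescopes to the
distances between the orbits of [0] and [f 0], hence is at most [L + 1].
After [n] steps it is at most [n + 1] for [2 ^ n] intervals, so the mean
diameter tends to [0] and every orbit is periodic up to a small mean error
([unimodal_mean_periodic]).

Averages.  Periodic sequences are combinations of the characters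
[n |-> exp (- 2 i pi n k / P)] ([periodic_fourier]).  For the error terms,
[|c_n|] is cut at a level [B]: below it the mean error is multiplied by [B], and
above it the moment of order [lambda > 1] gives a bound that tends to [0] as [B]
grows ([truncation], [oscillating_cesaro0]). *)

Set Implicit Arguments.
Unset Strict Implicit.
Unset Printing Implicit Defensive.

Import Order.TTheory GRing.Theory Num.Theory.
Import numFieldNormedType.Exports.
Import Normc.

Local Open Scope classical_set_scope.
Local Open Scope ring_scope.

(** * Horseshoes, flips and mean periodicity *)

Section Dynamics.
Variable R : realType.
Implicit Types (T g G : R -> R) (x y p q : R) (k m n N : nat).

Lemma continuous_iter T n : continuous T -> continuous (iter n T).
Proof.
move=> cT; elim: n => [|n IHn] x; first exact: cvg_id.
exact: (@continuous_comp _ _ _ (iter n T) T x (IHn x) (cT _)).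
Qed.

Lemma ivt g a b v : continuous g -> a <= b ->
  Num.min (g a) (g b) <= v <= Num.max (g a) (g b) ->
  exists2 x, a <= x <= b & g x = v.
Proof.
move=> cg ab vab.
have [x] := IVT ab (continuous_subspaceT cg) vab.
by rewrite in_itv /= => xab gx; exists x.
Qed.

Lemma ivt_strict g a b v : continuous g -> a <= b ->
  (g a < v < g b) || (g b < v < g a) -> exists2 x, a < x < b & g x = v.
Proof.
move=> cg ab gab; have [|x xab gx] := @ivt g a b v cg ab.
  rewrite ge_min le_max; case/orP: gab => /andP[? ?]; apply/andP; split; lra.
exists x => //; rewrite !lt_neqAle -andbA.
have [xa|xa] := eqVneq a x; first by move: gab; rewrite xa gx !ltxx andbF.
by have [xb|xb] := eqVneq x b; first by move: gab; rewrite -xb gx !ltxx andbF.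
Qed.

Definition monotone_on g u v :=
  (forall x y, u <= x -> x <= y -> y <= v -> g x <= g y) \/
  (forall x y, u <= x -> x <= y -> y <= v -> g y <= g x).

Lemma monotone_onP g u v : continuous g ->
  (forall x y, u <= x -> x < y -> y <= v -> g x <> g y) -> monotone_on g u v.
Proof.
move=> cg ginj.
have cg' : {within `[u, v], continuous g} by exact: continuous_subspaceT.
have gi : {in `[u, v] &, injective g}.
  move=> x y; rewrite !in_itv /= => /andP[ux xv] /andP[uy yv] gxy.
  by case: (ltgtP x y) => // xy; [case: (ginj x y)|case: (ginj y x)].
case: (lerP (g u) (g v)) => guv; [left|right] => x y ux xy yv.
  rewrite (segment_continuous_inj_le guv cg' gi) //;
  rewrite in_itv /=; apply/andP; split; lra.
rewrite (segment_continuous_inj_ge (ltW guv) cg' gi) //;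
rewrite in_itv /=; apply/andP; split; lra.
Qed.

(** [G] maps each of [[a1, a2]] and [[b1, b2]] strictly across [[a1, b2]], in
either direction; allowing both directions makes the notion invariant under
[x |-> - x]. *)
Definition horseshoe G a1 a2 b1 b2 :=
  [/\ -1 <= a1, a1 < a2, a2 < b1, b1 < b2 & b2 <= 1] /\
  [/\ Num.min (G a1) (G a2) < a1, b2 < Num.max (G a1) (G a2),
      Num.min (G b1) (G b2) < a1 & b2 < Num.max (G b1) (G b2)].

Definition has_horseshoe T :=
  exists N a1 a2 b1 b2, horseshoe (iter N T) a1 a2 b1 b2.

(** The two branches of [g] on [[q, 0]] and [[0, p]] both cover [[q, p]], but
these intervals meet and the cover is not strict at [p].  The preimages of
[[q, p]] under the words left-left and right-left are disjoint intervals inside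
the open interval, and [g \o g] maps each of them onto [[q, p]]. *)
Lemma fold_horseshoe g q p : continuous g -> -1 <= q -> p <= 1 -> q < 0 < p ->
  g q = p -> g p = p -> g 0 < q ->
  exists a1 a2 b1 b2, horseshoe (g \o g) a1 a2 b1 b2.
Proof.
move=> cg q1 p1 /andP[q0 p0] gq gp g0.
have [||c1 /andP[qc c0] gc1] := @ivt_strict g q 0 q cg; [lra|apply/orP; right; lra|].
have [||c2 /andP[d0 dp] gc2] := @ivt_strict g 0 p q cg; [lra|apply/orP; left; lra|].
have [||a1 /andP[qa ac] ga1] := @ivt_strict g q c1 c1 cg; [lra|apply/orP; right; lra|].
have [||b2 /andP[db bp] gb2] := @ivt_strict g c2 p c1 cg; [lra|apply/orP; left; lra|].
exists a1, c1, c2, b2; split; first by split; lra.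
rewrite /= ga1 gc1 gc2 gb2 gq gc1 !gt_min !lt_max.
by split; apply/orP; [left|right|right|left]; lra.
Qed.

(** Passing from [f] to [f \o f] on the smaller interval exchanges maxima and
minima; conjugation by [x |-> - x] restores the orientation. *)
Definition flip T x := - T (- x).

Lemma iter_flip n T : iter n (flip T) = flip (iter n T).
Proof.
apply/funext => x; elim: n => [|n IHn] /=; first by rewrite /flip /= opprK.
by rewrite IHn /flip opprK.
Qed.

Lemma continuous_flip T : continuous T -> continuous (flip T).
Proof.
move=> cT x; apply: cvgN.
by apply: continuous_comp; [exact: opp_continuous|exact: cT].
Qed.

Lemma has_horseshoe_flip T : has_horseshoe (flip T) -> has_horseshoe T.
Proof.
move=> [N [a1 [a2 [b1 [b2 [[? ? ? ? ?]]]]]]].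
rewrite iter_flip /flip => hs.
exists N, (- b2), (- b1), (- a2), (- a1); split; first by split; lra.
move: hs; set A1 := iter N T (- a1); set A2 := iter N T (- a2).
set B1 := iter N T (- b1); set B2 := iter N T (- b2).
by rewrite !gt_min !lt_max => -[? ? ? ?]; split; lra.
Qed.

(** The orbit is [P]-periodic up to an error whose upper mean is at most [e];
the constant absorbs a transient. *)
Definition periodic_upto T x (P : nat) (e : R) :=
  exists (w : nat -> R) (C : R), (forall n, w (n + P)%N = w n) /\
    forall N, \sum_(n < N) `|iter n T x - w n| <= C + e * N%:R.

Definition mean_periodic T x :=
  forall e, 0 < e -> exists2 P, (0 < P)%N & periodic_upto T x P e.

Lemma periodic_upto_flip T x P e :
  periodic_upto (flip T) (- x) P e -> periodic_upto T x P e.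
Proof.
move=> [w [C [wP wC]]]; exists (fun n => - w n), C; split => // [n|N]; first by rewrite wP.
apply: le_trans (wC N); rewrite le_eqVlt; apply/orP; left; apply/eqP.
by apply: eq_bigr => i _; rewrite iter_flip /flip !opprK -[RHS]normrN opprD !opprK.
Qed.

Lemma periodicM (V : Type) (w : nat -> V) P n j :
  (forall n, w (n + P)%N = w n) -> w (n + j * P)%N = w n.
Proof.
by move=> wP; elim: j => [|j IHj]; rewrite ?addn0 // mulSnr addnA wP.
Qed.

Lemma periodic_upto_iter j T x P e : (0 < P)%N -> 0 < e ->
  periodic_upto T (iter j T x) P e -> periodic_upto T x P e.
Proof.
move=> P0 e0 [w [C [wP wC]]].
(* [P.-1 * j] is congruent to [- j] modulo [P] *)
pose w' n := w (n + P.-1 * j)%N.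
exists w', (\sum_(n < j) `|iter n T x - w' n| + C).
split => // [n|N]; first by rewrite /w' addnAC wP.
have [Nj|jN] := leqP N j.
  apply: (@le_trans _ _ (\sum_(n < j) `|iter n T x - w' n|)).
    rewrite -!(big_mkord xpredT (fun n => `|iter n T x - w' n|)).
    rewrite (big_cat_nat _ Nj) //= lerDl.
    exact: sumr_ge0.
  have := wC 0%N; rewrite big_ord0 mulr0 addr0 => C0.
  have : 0 <= e * N%:R by rewrite mulr_ge0 // ltW.
  lra.
rewrite -!(big_mkord xpredT (fun n => `|iter n T x - w' n|)).
rewrite (big_cat_nat _ (ltnW jN)) //= -addrA lerD2l.
rewrite -[j in X in X <= _]addn0 addnC big_addn big_mkord.
apply: (@le_trans _ _ (C + e * (N - j)%:R)).
  apply: le_trans (wC (N - j)%N); rewrite le_eqVlt; apply/orP; left; apply/eqP.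
  apply: eq_bigr => i _; rewrite iterD /w'.
  have jP : (j + P.-1 * j = j * P)%N by rewrite -mulSn prednK // mulnC.
  by rewrite -addnA jP periodicM.
by rewrite lerD2l ler_pM2l // ler_nat leq_subr.
Qed.

Lemma cvg0_sum_le (a : nat -> R) (e : R) : a @ \oo --> (0 : R) -> 0 < e ->
  exists C, forall N, \sum_(n < N) `|a n| <= C + e * N%:R.
Proof.
move=> a0 e0; have [n0 _ an0] : \forall n \near \oo, `|a n| < e.
  by move/cvgr0Pnorm_lt : a0; exact.
exists (\sum_(n < n0) `|a n|); elim => [|N IHN].
  by rewrite big_ord0 mulr0 addr0; apply: sumr_ge0.
have [Nn0|n0N] := ltnP N n0.
  rewrite -!(big_mkord xpredT (fun n => `|a n|)).
  rewrite [X in _ <= X + _](big_cat_nat _ Nn0) //=.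
  rewrite -addrA lerDl addr_ge0 ?sumr_ge0 // mulr_ge0 // ltW //.
rewrite big_ord_recr /= -natr1.
have : `|a N| < e by apply: an0.
lra.
Qed.

(** A mean taken over consecutive blocks of length [m] controls the mean over
initial segments. *)
Lemma block_sum_le (a : nat -> R) (m : nat) (C S : R) : (0 < m)%N ->
  0 <= S -> (forall n, 0 <= a n) ->
  (forall j, \sum_(i < j) \sum_(k < m) a (i * m + k)%N <= C + S * j%:R) ->
  forall N, \sum_(n < N) a n <= (C + S) + S / m%:R * N%:R.
Proof.
move=> m0 S0 a0 aS N.
have blocks j : \sum_(n < j * m) a n = \sum_(i < j) \sum_(k < m) a (i * m + k)%N.
  elim: j => [|j IHj]; first by rewrite !big_ord0.
  by rewrite mulSn addnC big_split_ord /= big_ord_recr /= IHj.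
have Nm : (N <= (N %/ m).+1 * m)%N by rewrite ltnW // ltn_ceil.
apply: (@le_trans _ _ (\sum_(n < (N %/ m).+1 * m) a n)).
  rewrite -!(big_mkord xpredT a) [X in _ <= X](big_cat_nat _ Nm) //=.
  by rewrite lerDl sumr_ge0.
rewrite blocks; apply: le_trans (aS _) _.
rewrite -addrA lerD2l -natr1 mulrDr mulr1 [X in X <= _]addrC.
rewrite lerD2l -mulrA ler_wpM2l //.
rewrite ler_pdivlMl ?ltr0n // mulrC -natrM ler_nat.
exact: leq_trunc_div.
Qed.

Lemma monotone_on_dist g u v x : monotone_on g u v -> u <= x <= v ->
  `|g x - g u| <= `|g v - g u| /\ `|g x - g v| <= `|g u - g v|.
Proof.
move=> mg /andP[ux xv].
case: mg => mg; have a := mg u x (lexx u) ux xv; have b := mg x v ux xv (lexx v).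
  by split; [rewrite !ger0_norm|rewrite !ler0_norm]; lra.
by split; [rewrite !ler0_norm|rewrite !ger0_norm]; lra.
Qed.

Lemma monotone_on_distD g u v x : monotone_on g u v -> u <= x <= v ->
  `|g x - g u| + `|g x - g v| = `|g v - g u|.
Proof.
move=> mg /andP[ux xv].
case: mg => mg; have a := mg u x (lexx u) ux xv; have b := mg x v ux xv (lexx v).
  by rewrite (@ger0_norm _ (g x - g u)) ?(@ler0_norm _ (g x - g v))
    ?(@ger0_norm _ (g v - g u)); lra.
by rewrite (@ler0_norm _ (g x - g u)) ?(@ger0_norm _ (g x - g v))
  ?(@ler0_norm _ (g v - g u)); lra.
Qed.

(** * Renormalization *)

(** The turning point is [0] and the fixed end point [p] is on the left.  The
equation [T q = T p], stronger than [iter m T q = iter m T p], makes the orbits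
of [p] and [q] coincide from the first step on, so that a point on the right of
[0] can be replaced by one on the left in all estimates along the orbit. *)
Record unimodal_return T m p q : Prop := UnimodalReturn {
  ur_gt0 : (0 < m)%N ;
  ur_p : -1 <= p < 0 ;
  ur_q : 0 < q <= 1 ;
  ur_fix : iter m T p = p ;
  ur_glue : T q = T p ;
  ur_stable : forall x, p <= x <= q -> p <= iter m T x <= q ;
  ur_incr : forall x y, p <= x -> x < y -> y <= 0 -> iter m T x < iter m T y ;
  ur_decr : forall x y, 0 <= x -> x < y -> y <= q -> iter m T y < iter m T x
}.

Definition spread T m p := \sum_(k < m) `|iter k T p - iter k T 0|.

Lemma iter_eq_le T k m x y : (k <= m)%N ->
  iter k T x = iter k T y -> iter m T x = iter m T y.
Proof. by move=> km xy; rewrite -(subnK km) !iterD xy. Qed.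

Lemma iterSm T k x y : T x = T y -> iter k.+1 T x = iter k.+1 T y.
Proof. exact: (@iter_eq_le T 1 k.+1). Qed.

Section Return.
Variables (T : R -> R) (m : nat) (p q : R).
Hypotheses (cT : continuous T) (ur : unimodal_return T m p q).

Lemma ur_monoL k : (k <= m)%N -> monotone_on (iter k T) p 0.
Proof.
move=> km; apply: monotone_onP; first exact: continuous_iter.
move=> x y px xy y0 /(iter_eq_le km) fxy.
by have := ur_incr ur px xy y0; rewrite fxy ltxx.
Qed.

Lemma ur_monoR k : (k <= m)%N -> monotone_on (iter k T) 0 q.
Proof.
move=> km; apply: monotone_onP; first exact: continuous_iter.
move=> x y px xy y0 /(iter_eq_le km) fxy.
by have := ur_decr ur px xy y0; rewrite fxy ltxx.
Qed.

(** Injectivity of [T] on [[0, q]] puts [T y] strictly between [T 0] and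
[T q = T p]. *)
Lemma ur_fold y : 0 < y < q -> exists2 x, p < x < 0 & T x = T y.
Proof.
move=> /andP[y0 yq]; have /andP[p1 p0] := ur_p ur.
have m0 := ur_gt0 ur.
have n1 : T y != T 0.
  apply/eqP => /(@iter_eq_le T 1 m _ _ m0) fy.
  by have := ur_decr ur (lexx 0) y0 (ltW yq); rewrite fy ltxx.
have n2 : T y != T p.
  apply/eqP; rewrite -(ur_glue ur) => /(@iter_eq_le T 1 m _ _ m0) fy.
  by have := ur_decr ur (ltW y0) yq (lexx q); rewrite fy ltxx.
apply: ivt_strict; [exact: cT | exact: ltW |].
rewrite -(ur_glue ur) in n2 *.
case: (@ur_monoR 1 m0) => /= mT; have a := mT 0 y (lexx 0) (ltW y0) (ltW yq);
  have b := mT y q (ltW y0) (ltW yq) (lexx q); apply/orP; [right|left];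
  by apply/andP; split; rewrite lt_neqAle ?a ?b andbT // eq_sym.
Qed.

(** Up to time [m] the iterates are injective on [[p, 0]], hence the image of
[[p, q]] at a positive time is the interval between the images of [p] and [0]. *)
Lemma ur_dist k x : (0 < k <= m)%N -> p <= x <= q ->
  `|iter k T x - iter k T 0| <= `|iter k T p - iter k T 0|.
Proof.
move=> /andP[k0 km] /andP[px xq].
have dL y : p <= y <= 0 ->
    `|iter k T y - iter k T 0| <= `|iter k T p - iter k T 0|.
  by move=> py; have [] := monotone_on_dist (ur_monoL km) py.
have [x0|x0] := leP x 0; first by apply: dL; rewrite px.
move: xq; rewrite le_eqVlt => /orP[/eqP ->|xq].
  rewrite -(prednK k0) (@iterSm _ _ q p) //; exact: ur_glue ur.
have [|y /andP[py y0] Ty] := @ur_fold x; first by rewrite x0.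
rewrite -(prednK k0) -(@iterSm _ _ y x) // prednK //.
by apply: dL; rewrite !ltW.
Qed.

Lemma ur_spread x : p <= x <= q ->
  \sum_(k < m) `|iter k T x - iter k T 0| <= 1 + spread T m p.
Proof.
move=> xpq; rewrite /spread; move: (@ur_dist) (ur_gt0 ur).
case: m => // m' dist _; rewrite !big_ord_recl /= !subr0 lerD //.
  have := ur_p ur; have := ur_q ur; move: xpq => /andP[? ?] /andP[? ?] /andP[? ?].
  have := normr_ge0 p; rewrite ler_norml; move=> ?; apply/andP; split; lra.
apply: ler_wpDl => //; apply: ler_sum => k _.
by apply: (dist (lift ord0 k)) => //; rewrite lift0; apply: ltnW; exact: ltn_ord.
Qed.

Lemma ur_stable_iter i x : p <= x <= q -> p <= iter (i * m) T x <= q.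
Proof.
move=> xpq; elim: i => // i IHi.
by rewrite mulSn iterD; exact: ur_stable ur _ IHi.
Qed.

Lemma ur_periodic_upto x : p <= x <= q ->
  periodic_upto T x m ((1 + spread T m p) / m%:R).
Proof.
move=> xpq.
have S0 : 0 <= 1 + spread T m p by rewrite addr_ge0 // sumr_ge0.
exists (fun n => iter (n %% m) T 0), (0 + (1 + spread T m p)).
split=> [n|]; first by rewrite modnDr.
apply: (@block_sum_le (fun n => `|iter n T x - iter (n %% m) T 0|)) => //.
  exact: ur_gt0 ur.
move=> j; rewrite add0r mulr_natr -[j in _ *+ j]card_ord -sumr_const.
apply: ler_sum => i _; apply: le_trans (ur_spread (ur_stable_iter i xpq)).
rewrite le_eqVlt; apply/orP; left; apply/eqP; apply: eq_bigr => k _.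
by rewrite modnMDl modn_small // addnC iterD.
Qed.

(** [iter m T] is increasing on [[p, 0]], so an orbit that stays there is
monotone and converges. *)
Lemma ur_converges x e : 0 < e -> (forall i, p <= iter (i * m) T x <= 0) ->
  periodic_upto T x m e.
Proof.
move=> e0 yp; pose y i := iter (i * m) T x.
have yS i : y i.+1 = iter m T (y i) by rewrite /y mulSn iterD.
have incr u v : p <= u -> v <= 0 -> u <= v -> iter m T u <= iter m T v.
  move=> pu v0; rewrite le_eqVlt => /orP[/eqP -> //|uv].
  exact: ltW (ur_incr ur pu uv v0).
have p0 i : p <= y i by have /andP[] := yp i.
have y0 i : y i <= 0 by have /andP[] := yp i.
have [l yl] : exists l : R, y @ \oo --> l.
  have [y01|y10] := leP (y 0%N) (y 1%N).
    suff : cvgn y by move=> cy; exists (limn y).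
    apply: nondecreasing_is_cvgn; last by exists 0 => _ [i _ <-].
    by apply/nondecreasing_seqP; elim=> // i IHi; rewrite (yS i) (yS i.+1) incr.
  suff : cvgn y by move=> cy; exists (limn y).
  apply: nonincreasing_is_cvgn; last by exists p => _ [i _ <-].
  apply/nonincreasing_seqP; elim=> [|i IHi]; first exact: ltW.
  by rewrite (yS i) (yS i.+1) incr.
have m0 := ur_gt0 ur.
pose b i := \sum_(k < m) `|iter (i * m + k) T x - iter k T l|.
have b0 : b @ \oo --> (0 : R).
  have -> : (0 : R) = \sum_(k < m) 0 by rewrite big1.
  apply: (@cvg_big R _ +%R 0 xpredT add_continuous) => k _.
  apply/norm_cvg0P.
  under eq_fun do rewrite addnC iterD.
  apply/subr_cvg0.
  exact: continuous_cvg (@continuous_iter T k cT l) yl.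
have em0 : 0 < e * m%:R by rewrite mulr_gt0 // ltr0n.
have [C bC] := cvg0_sum_le b0 em0.
exists (fun n => iter (n %% m) T l), (C + e * m%:R).
split=> [n|N]; first by rewrite modnDr.
have := @block_sum_le (fun n => `|iter n T x - iter (n %% m) T l|) m C _ m0 (ltW em0).
rewrite mulfK ?pnatr_eq0 -?lt0n //; apply => // j.
apply: le_trans (bC j); apply: ler_sum => i _.
apply: le_trans (ler_norm _); rewrite /b le_eqVlt; apply/orP; left; apply/eqP.
by apply: eq_bigr => k _; rewrite modnMDl modn_small.
Qed.

(** One renormalization: [p'] is the fixed point of [f] between [0] and [f 0],
and [q'] is its other preimage. *)
Lemma ur_step : ~ has_horseshoe T ->
  (forall x e, 0 < e -> p <= x <= q -> periodic_upto T x m e) \/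
  exists p' q', [/\ unimodal_return (flip T) (m + m) (- p') (- q'),
    spread (flip T) (m + m) (- p') <= 1 + spread T m p &
    forall x, p <= x <= q ->
      (forall e, 0 < e -> periodic_upto T x m e) \/
      exists j, - p' <= - iter j T x <= - q'].
Proof.
move=> nh; have m0 := ur_gt0 ur.
have /andP[p1 p0] := ur_p ur; have /andP[q0 q1] := ur_q ur.
have stable := ur_stable ur; have incr := ur_incr ur; have decr := ur_decr ur.
have fp := ur_fix ur.
pose f := iter m T; rewrite -/f in stable incr decr fp.
have cf : continuous f by exact: continuous_iter.
have fq : f q = p by rewrite -[RHS]fp; apply: (iter_eq_le m0); exact: ur_glue ur.
have /andP[pf0 f0q] : p <= f 0 <= q by apply: stable; rewrite !ltW.
(* [f 0] is the maximum of [f] on [[p, q]] *)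
have fle0 x : p <= x <= q -> f x <= f 0.
  move=> /andP[px xq]; case: (ltgtP x 0) => [x0|x0|->] //.
    by rewrite ltW ?incr.
  by rewrite ltW ?decr.
have conv x e : 0 < e -> (forall i, p <= iter (i * m) T (f x) <= 0) ->
    periodic_upto T x m e.
  by move=> e0 h; apply: (@periodic_upto_iter m) => //; exact: ur_converges.
have fS i x : f (iter (i * m) T x) = iter (i.+1 * m) T x by rewrite mulSn iterD.
have fSr i x : iter (i * m) T (f x) = iter (i.+1 * m) T x by rewrite mulSn addnC iterD.
have fst i x : p <= x <= q -> p <= iter (i * m) T x <= q.
  exact: ur_stable_iter.
have [f00|f00] := leP (f 0) 0.
  left=> x e e0 xpq; apply: conv => // i; rewrite fSr -fS.
  have /andP[-> _] := stable _ (fst i _ xpq).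
  by rewrite (le_trans (fle0 _ (fst i _ xpq))).
right.
have [|||p' /andP[p'0 p'f] fp'0] := @ivt_strict (fun x => f x - x) 0 (f 0) 0.
- by move=> x; apply: cvgB; [exact: cf|exact: cvg_id].
- exact: ltW.
- have ff : f (f 0) < f 0 by apply: decr.
  by apply/orP; right; apply/andP; split; lra.
have fp' : f p' = p' by lra.
have [|q' /andP[pq' q'0] Tq'] := @ur_fold p'; first by rewrite p'0 (lt_le_trans p'f).
have fq' : f q' = p' by rewrite -[RHS]fp'; apply: (iter_eq_le m0).
have ffE x : iter (m + m) T x = f (f x) by rewrite iterD.
have ff0 : q' <= f (f 0).
  rewrite leNgt; apply/negP => ff0; apply: nh.
  have [|||||||a1 [a2 [b1 [b2 hs]]]] := @fold_horseshoe (f \o f) q' p'.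
  - by move=> x; apply: continuous_comp; exact: cf.
  - lra.
  - lra.
  - by rewrite q'0.
  - by rewrite /= fq' fp'.
  - by rewrite /= fp'.
  - exact: ff0.
  exists (m + m + (m + m))%N, a1, a2, b1, b2.
  suff -> : iter (m + m + (m + m)) T = (f \o f) \o (f \o f) by [].
  by apply/funext => x; rewrite !iterD.
have p'q : p' < q by exact: lt_le_trans f0q.
have fJ y : q' <= y <= p' -> p' <= f y <= f 0.
  move=> /andP[qy yp]; rewrite fle0 ?andbT; last by apply/andP; split; lra.
  have [y0|y0] := leP y 0.
    move: qy; rewrite le_eqVlt => /orP[/eqP <-|qy]; first by rewrite fq'.
    by rewrite -fq' ltW // incr // ltW.
  move: yp; rewrite le_eqVlt => /orP[/eqP ->|yp]; first by rewrite fp'.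
  by rewrite -[X in X <= _]fp' ltW // decr // ltW.
have fK z : p' <= z <= f 0 -> q' <= f z <= p'.
  move=> /andP[pz zf]; apply/andP; split.
    move: zf; rewrite le_eqVlt => /orP[/eqP -> //|zf].
    by rewrite (le_trans ff0) // ltW // decr //; lra.
  move: pz; rewrite le_eqVlt => /orP[/eqP <-|pz]; first by rewrite fp'.
  by rewrite -[X in _ <= X]fp' ltW // decr //; lra.
exists p', q'; split.
- split => //; rewrite ?iter_flip /flip ?opprK.
  + by rewrite addn_gt0 m0.
  + by apply/andP; split; lra.
  + by apply/andP; split; lra.
  + by rewrite ffE !fp'.
  + by rewrite Tq'.
  + move=> x xpq; rewrite ffE !lerN2 andbC.
    by apply/fK/fJ; move: xpq => /andP[? ?]; apply/andP; split; lra.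
  + move=> x y px xy y0; rewrite !ffE ltrN2.
    have /andP[fy1 fy2] : p' <= f (- y) <= f 0 by apply: fJ; apply/andP; split; lra.
    have /andP[fx1 fx2] : p' <= f (- x) <= f 0 by apply: fJ; apply/andP; split; lra.
    by apply: (decr); [lra|apply: decr; lra|lra].
  + move=> x y px xy y0; rewrite !ffE ltrN2.
    have /andP[fy1 fy2] : p' <= f (- y) <= f 0 by apply: fJ; apply/andP; split; lra.
    have /andP[fx1 fx2] : p' <= f (- x) <= f 0 by apply: fJ; apply/andP; split; lra.
    by apply: decr; [lra|apply: incr; lra|lra].
- rewrite /spread big_split_ord /= -big_split /=.
  apply: le_trans (ur_spread (_ : p <= f 0 <= q)); last by rewrite pf0.
  apply: ler_sum => k _.
  (* [p'] lies between [0] and [f 0], so the two distances add up *)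
  have mono0f : monotone_on (iter k T) 0 (f 0).
    have := ur_monoR (ltnW (ltn_ord k)).
    by case=> mk; [left|right] => x y ? ? ?; apply: mk => //; lra.
  have p'0f : 0 <= p' <= f 0 by rewrite !ltW.
  rewrite -(monotone_on_distD mono0f p'0f).
  rewrite !iter_flip /flip !opprK oppr0 ![(m + k)%N]addnC !iterD -/(f _) fp'.
  by rewrite ![- _ + _]addrC !(distrC _ (iter k T p')).
- move=> x xpq.
  have [[i /andP[qi ip]]|no] :=
    pselect (exists i, q' <= iter (i * m) T x <= p').
    by right; exists (i * m)%N; rewrite !lerN2 ip.
  left=> e e0; apply: conv => // i; rewrite fSr.
  have /andP[pz _] := fst i.+1 _ xpq; rewrite pz /=.
  have zf0 : iter (i.+1 * m) T x <= f 0 by rewrite -fS fle0 // fst.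
  rewrite leNgt; apply/negP => z0.
  (* a point of [(p', f 0]] is mapped into [[q', p']] at the next step *)
  have [zp|pz'] := leP (iter (i.+1 * m) T x) p'.
    by apply: no; exists i.+1; rewrite zp andbT; lra.
  apply: no; exists i.+2; rewrite -fS; apply: fK.
  by rewrite zf0 ltW.
Qed.

End Return.

Lemma periodic_upto_le T x P e e' :
  e <= e' -> periodic_upto T x P e -> periodic_upto T x P e'.
Proof.
move=> ee [w [C [wP wC]]]; exists w, C; split=> // N.
by apply: le_trans (wC N) _; rewrite lerD2l ler_wpM2r.
Qed.

Lemma ur_periodic n : forall T m p q x, continuous T -> ~ has_horseshoe T ->
  unimodal_return T m p q -> p <= x <= q ->
  mean_periodic T x \/
  periodic_upto T x (2 ^ n * m)%N ((1 + n%:R + spread T m p) / (2 ^ n * m)%:R).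
Proof.
elim: n => [|n IHn] T m p q x cT nh ur xpq.
  by right; rewrite addr0 mul1n; exact: ur_periodic_upto ur _ xpq.
have m0 := ur_gt0 ur.
have [conv|[p' [q' [ur' spread_le /(_ _ xpq)]]]] := ur_step cT ur nh.
  by left => e e0; exists m => //; exact: conv.
case=> [conv|[j jpq]]; first by left => e e0; exists m => //; exact: conv.
have nh' : ~ has_horseshoe (flip T) by move=> /has_horseshoe_flip.
have [mp|up] := IHn _ _ _ _ _ (continuous_flip cT) nh' ur' jpq.
  left=> e e0; have [P P0 up] := mp e e0.
  by exists P => //; apply: (periodic_upto_iter P0 e0); exact: (periodic_upto_flip up).
right; have mE : (2 ^ n.+1 * m = 2 ^ n * (m + m))%N.
  by rewrite expnS addnn -mul2n mulnCA mulnA.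
have pos : 0 < ((2 ^ n * (m + m))%:R : R).
  by rewrite ltr0n muln_gt0 expn_gt0 addn_gt0 m0.
rewrite mE; apply: (@periodic_upto_iter j).
- by rewrite -(ltr0n R).
- have s0 : 0 <= spread T m p by apply: sumr_ge0.
  by rewrite divr_gt0 //; have := ler0n R n.+1; lra.
apply: periodic_upto_flip; apply: periodic_upto_le up.
rewrite ler_pM2r ?invr_gt0 // -natr1; lra.
Qed.

(** After [2 k] renormalizations the mean error is at most
[(2 k + 2) / 4 ^ k <= 2 / 2 ^ k]. *)
Theorem unimodal_mean_periodic T x : continuous T -> ~ has_horseshoe T ->
  unimodal_return T 1 (-1) 1 -> -1 <= x <= 1 -> mean_periodic T x.
Proof.
move=> cT nh ur x1 e e0.
pose k := Num.bound (2 / e).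
have ek : 2 / e < k%:R by apply: archi_boundP; rewrite divr_ge0 // ltW.
have [mp|up] := @ur_periodic (2 * k) _ _ _ _ _ cT nh ur x1; first exact: mp.
exists (2 ^ (2 * k) * 1)%N; first by rewrite muln1 expn_gt0.
apply: periodic_upto_le up.
have k2 : (k.+1%:R : R) <= (2 ^ k)%:R by rewrite ler_nat ltn_expl.
have p0 : 0 < ((2 ^ k)%:R : R) by rewrite ltr0n expn_gt0.
rewrite muln1 mulnC expnM natrX /spread big_ord1 /= subr0 normrN normr1.
rewrite ler_pdivrMr ?exprn_gt0 // natrM.
move: k2; rewrite -natr1; set K := (2 ^ k)%:R in p0 * => k2.
have : 2 < e * K by rewrite mulrC -ltr_pdivrMr //; lra.
nra.
Qed.

End Dynamics.

(** * Horseshoes are stable and force positive entropy *)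

Section Near.
Variable R : realType.
Implicit Types (S T G : R -> R).

Definition uniformly_near S (P : (R -> R) -> Prop) :=
  exists2 d : R, 0 < d & forall S', (forall x, `|S' x - S x| < d) -> P S'.

Lemma uniformly_near_and S P Q : uniformly_near S P -> uniformly_near S Q ->
  uniformly_near S (fun S' => P S' /\ Q S').
Proof.
move=> [d d0 dP] [d' d'0 d'Q]; exists (Num.min d d'); first by rewrite lt_min d0.
move=> S' SS'; split; [apply: dP|apply: d'Q] => x;
  by have := SS' x; rewrite lt_min => /andP[].
Qed.

Lemma iter_uniformly_near S n x e : continuous S -> 0 < e ->
  uniformly_near S (fun S' => `|iter n S' x - iter n S x| < e).
Proof.
move=> cS; elim: n e => [|n IHn] e e0.
  by exists 1 => // S' _; rewrite subrr normr0.
have e20 : 0 < e / 2 by rewrite divr_gt0.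
have /cvgrPdist_lt /(_ _ e20) /nbhs_ballP[d /= d0 dS] := cS (iter n S x).
have [d' d'0 d'S] := IHn d d0.
exists (Num.min d' (e / 2)); first by rewrite lt_min d'0.
move=> S' SS'; have lt1 : `|iter n S' x - iter n S x| < d.
  by apply: d'S => y; have := SS' y; rewrite lt_min => /andP[].
have lt2 : `|S' (iter n S' x) - S (iter n S' x)| < e / 2.
  by have := SS' (iter n S' x); rewrite lt_min => /andP[].
have lt3 : `|S (iter n S x) - S (iter n S' x)| < e / 2.
  by apply: dS; rewrite /ball /= distrC.
rewrite /= -(subrK (S (iter n S' x)) (S' _)) -addrA.
apply: le_lt_trans (ler_normD _ _) _.
rewrite distrC in lt3; lra.
Qed.

Lemma horseshoe_uniformly_near S : continuous S -> has_horseshoe S ->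
  uniformly_near S (@has_horseshoe R).
Proof.
move=> cS [N [a1 [a2 [b1 [b2 [ord [h1 h2 h3 h4]]]]]]].
have lt x v : iter N S x < v -> uniformly_near S (fun S' => iter N S' x < v).
  rewrite -subr_gt0 => /(iter_uniformly_near N x cS)[d d0 dS].
  by exists d => // S' /dS; rewrite ltr_norml; lra.
have gt x v : v < iter N S x -> uniformly_near S (fun S' => v < iter N S' x).
  rewrite -subr_gt0 => /(iter_uniformly_near N x cS)[d d0 dS].
  by exists d => // S' /dS; rewrite ltr_norml; lra.
have ltm x y v : Num.min (iter N S x) (iter N S y) < v ->
    uniformly_near S (fun S' => Num.min (iter N S' x) (iter N S' y) < v).
  by rewrite gt_min => /orP[] /lt[d d0 dS]; exists d => // S' /dS;
    rewrite gt_min => ->; rewrite ?orbT.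
have gtm x y v : v < Num.max (iter N S x) (iter N S y) ->
    uniformly_near S (fun S' => v < Num.max (iter N S' x) (iter N S' y)).
  by rewrite lt_max => /orP[] /gt[d d0 dS]; exists d => // S' /dS;
    rewrite lt_max => ->; rewrite ?orbT.
have [d d0 dS] := uniformly_near_and (uniformly_near_and (ltm _ _ _ h1) (gtm _ _ _ h2))
  (uniformly_near_and (ltm _ _ _ h3) (gtm _ _ _ h4)).
exists d => // S' /dS[[? ?] [? ?]].
by exists N, a1, a2, b1, b2.
Qed.

(** The point is built from the end of the word: the image is any point of
[[a1, b2]] with the shifted itinerary, and each of the two intervals contains
one of its preimages. *)
Lemma horseshoe_itinerary G a1 a2 b1 b2 (w : seq bool) : continuous G ->
  horseshoe G a1 a2 b1 b2 ->
  exists2 x, a1 <= x <= b2 & forall i, (i < size w)%N ->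
    if nth false w i then a1 <= iter i G x <= a2 else b1 <= iter i G x <= b2.
Proof.
move=> cG [[_ a12 ab b12 _] [h1 h2 h3 h4]].
elim: w => [|c w [y /andP[ay yb] yw]]; first by exists a1 => //; lra.
have [x xc xy] : exists2 x, if c then a1 <= x <= a2 else b1 <= x <= b2 & G x = y.
  case: c; (apply: ivt => //; first exact: ltW); apply/andP; split.
  - exact: le_trans (ltW h1) ay.
  - exact: le_trans yb (ltW h2).
  - exact: le_trans (ltW h3) ay.
  - exact: le_trans yb (ltW h4).
exists x.
  by move: xc; case: (c) => /andP[? ?]; apply/andP; split; lra.
by case=> [//|i] /= iw; rewrite -iterS iterSr xy; exact: yw.
Qed.

End Near.

Section Extension.
Variable R : realType.

Lemma clamp_subproof (x : R) : Num.max (-1) (Num.min 1 x) \in I11 R.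
Proof. by apply: I11P; rewrite le_max lexx /= ge_max ge_min lexx ge0_cp. Qed.

Definition clamp (x : R) : I11 R := SigSub (clamp_subproof x).

Lemma val_I11 (x : I11 R) : -1 <= \val x <= 1.
Proof. by have := valP x; rewrite inE /I11 /= in_itv. Qed.

Lemma clampE (x : R) : -1 <= x <= 1 -> \val (clamp x) = x.
Proof. by move=> /andP[x1 x2] /=; rewrite (min_idPr x2) (max_idPr x1). Qed.

Lemma clampK (x : I11 R) : clamp (\val x) = x.
Proof. by apply/val_inj; rewrite clampE // val_I11. Qed.

(** The extension is constant outside the interval, which makes it continuous
on the whole line with the same orbits. *)
Definition ext (T : I11 R -> I11 R) (x : R) : R := \val (T (clamp x)).

Lemma ext_itv T x : -1 <= ext T x <= 1. Proof. exact: val_I11. Qed.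

Lemma ext_val T x : ext T (\val x) = \val (T x).
Proof. by rewrite /ext clampK. Qed.

Lemma iter_ext T n x : iter n (ext T) (\val x) = \val (iter n T x).
Proof. by elim: n => //= n ->; exact: ext_val. Qed.

Lemma continuous_val : continuous (fun x : I11 R => \val x : R).
Proof. exact: initial_continuous. Qed.

Lemma continuous_clamp : continuous clamp.
Proof.
apply: (@continuous_comp_initial _ _ _ set_val) => x.
apply: (@continuous_max R R (cst (-1)) (fun x => Num.min 1 x)); first exact: cvg_cst.
by apply: (@continuous_min R R (cst 1) id); [exact: cvg_cst|exact: cvg_id].
Qed.

Lemma continuous_ext T : continuous T -> continuous (ext T).
Proof.
move=> cT x; apply: (@continuous_comp _ _ _ (T \o clamp) (fun y => \val y)).
  by apply: continuous_comp; [exact: continuous_clamp|exact: cT].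
exact: continuous_val.
Qed.

Local Open Scope ereal_scope.

Lemma limn_esup_ge (u : nat -> \bar R) (l : \bar R) :
  (forall n, exists2 k, (n <= k)%N & l <= u k) -> l <= limn_esup u.
Proof.
move=> ul; rewrite limn_esup_lim; apply: lime_ge; first exact: is_cvg_esups.
apply: nearW => n; have [k nk lk] := ul n; apply: le_trans lk _.
by apply: ereal_sup_ubound; exists k.
Qed.

(** Points with different itineraries of length [n] are, at some time before
[n * N], in different intervals of the horseshoe, hence apart by its gap
[b1 - a2].  This gives [2 ^ n] separated points and entropy at least
[ln 2 / N]. *)
Lemma horseshoe_ent_gt0 T : continuous T -> has_horseshoe (ext T) -> 0 < ent T.
Proof.
move=> cT [N [a1 [a2 [b1 [b2 hs]]]]].
have cG : continuous (iter N (ext T)) by apply/continuous_iter/continuous_ext.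
have [[a1m a12 ab b12 b2M] [h1 h2 _ _]] := hs.
have N0 : (0 < N)%N.
  by case: (N) h1 h2 => //=; rewrite gt_min lt_max; lra.
pose e := (b1 - a2)%R.
have e0 : (0 < e)%R by rewrite subr_gt0.
have sep n : ((2 ^ n)%:R)%:E <= max_separated T (n * N)%N e.
  have pt (w : n.-tuple bool) : {x : I11 R | forall i, (i < n)%N ->
      if nth false w i then (a1 <= iter (i * N) (ext T) (\val x) <= a2)%R
      else (b1 <= iter (i * N) (ext T) (\val x) <= b2)%R}.
    apply: cid; have [x xab xw] := horseshoe_itinerary w cG hs.
    have x11 : (-1 <= x <= 1)%R by move: xab => /andP[? ?]; apply/andP; split; lra.
    exists (clamp x) => i ni; rewrite clampE // iterM.
    by apply: xw; rewrite size_tuple.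
  have pt_sep w w' : w != w' -> exists2 k, (k < n * N)%N &
      ~ ball (iter k T (sval (pt w))) e (iter k T (sval (pt w'))).
    move=> ww'; have [i ni wi] : exists2 i, (i < n)%N & nth false w i != nth false w' i.
      apply: contrapT => nex; move/eqP: ww'; apply; apply/val_inj.
      apply: (@eq_from_nth _ false); rewrite ?size_tuple // => i ni.
      by apply/eqP/negPn/negP => wi; apply: nex; exists i.
    exists (i * N)%N; first by rewrite ltn_pmul2r.
    have := svalP (pt w) i ni; have := svalP (pt w') i ni.
    rewrite !iter_ext.
    set x := iter _ T (sval (pt w)); set y := iter _ T (sval (pt w')).
    rewrite /ball /= => yw xw.
    suff : (e <= `|\val x - \val y|)%R by rewrite leNgt => /negP.
    have := ler_norm (\val x - \val y)%R; have := ler_norm (\val y - \val x)%R.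
    rewrite distrC /e; move: wi xw yw.
    by case: (nth _ w i); case: (nth _ w' i) => //= _ /andP[? ?] /andP[? ?]; lra.
  pose A := [fset x in [seq sval (pt w) | w <- enum {: n.-tuple bool}]]%fset.
  apply: ereal_sup_ubound; exists A => /=.
    move=> x y; rewrite !inE => /mapP[w _ ->] /mapP[w' _ ->] xy.
    by apply: pt_sep; apply: contra_neq xy => ->.
  have uA : uniq [seq sval (pt w) | w <- enum {: n.-tuple bool}].
    rewrite map_inj_uniq ?enum_uniq // => w w' ptw; apply/eqP/negPn/negP.
    by move=> /pt_sep[k _]; rewrite ptw; apply; exact: ballxx.
  by rewrite card_fseq undup_id // size_map -cardE card_tuple card_bool.
have ln20 : (0 < N%:R^-1 * ln (2 : R))%R.
  by rewrite mulr_gt0 ?invr_gt0 ?ltr0n // ln_gt0 // ltr1n.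
apply: (@lt_le_trans _ _ (N%:R^-1 * ln 2)%:E); first by rewrite lte_fin.
apply: (@le_trans _ _ (limn_esup (fun n => (n%:R^-1)%:E * lne (max_separated T n e)))).
  apply: limn_esup_ge => n; exists (n.+1 * N)%N.
    by rewrite (leq_trans (leqnSn n)) // leq_pmulr.
  apply: (@le_trans _ _ (((n.+1 * N)%:R^-1)%:E * lne ((2 ^ n.+1)%:R)%:E)).
    rewrite lne_EFin ?ltr0n ?expn_gt0 // -EFinM lee_fin natrX lnXn //.
    by rewrite -[(ln 2 *+ _)%R]mulr_natl natrM invfM mulrACA mulVf ?mul1r ?pnatr_eq0.
  rewrite lee_pmul2l // ?lte_fin ?invr_gt0 ?ltr0n ?muln_gt0 ?N0 //.
  rewrite lee_lne ?sep // in_itv /= leey andbT ?lee_fin //.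
  exact: le_trans (sep _).
by apply: ereal_sup_ubound; exists e.
Qed.

End Extension.

(** * Feigenbaum maps *)

Section Quadratic.
Variable R : realType.

Lemma clamp_dnbhs (x : R) : -1 < x < 1 ->
  clamp (h + x) @[h --> 0^'] --> (clamp x)^'.
Proof.
move=> /andP[x1 x2] A; rewrite /dnbhs /within /= => Ax.
have cx : clamp (h + x) @[h --> (0 : R)] --> clamp (0 + x).
  apply: (@continuous_comp _ _ _ (fun h : R => h + x) (@clamp R)).
    by apply: cvgD; [exact: cvg_id|exact: cvg_cst].
  exact: continuous_clamp.
rewrite add0r in cx.
have d0 : 0 < Num.min (1 - x) (x + 1) by rewrite lt_min; apply/andP; split; lra.
rewrite /nbhs /= /within /=.
near=> h => h0.
have : (clamp (h + x) != clamp x -> A (clamp (h + x))) by near: h; exact: cx Ax.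
apply; apply/eqP => /(congr1 val).
have hd : `|h| < Num.min (1 - x) (x + 1).
  by near: h; exact: (@nbhs0_lt _ R).
move: hd; rewrite lt_min => /andP[/ltr_normlP[? ?] /ltr_normlP[? ?]].
rewrite !clampE; [|apply/andP; split; lra|apply/andP; split; lra].
by move/eqP: h0; lra.
Unshelve. all: by end_near. Qed.

Lemma continuous_slope (g : I11 R -> R) (x : I11 R) :
  cvg (slope g x y @[y --> x^']) -> {for x, continuous g}.
Proof.
move=> cs; apply/continuous_withinNx.
have gE : (fun y => g x + slope g x y * (\val y - \val x)) = g.
  apply/funext => y; rewrite /slope.
  have [->|yx] := eqVneq y x; first by rewrite !subrr mulr0 addr0.
  have yx0 : \val y - \val x != 0.
    by rewrite subr_eq0; apply: contra_neq yx => /val_inj.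
  by rewrite divfK // addrCA subrr addr0.
have : (fun y => g x + slope g x y * (\val y - \val x)) @ x^' -->
    g x + lim (slope g x y @[y --> x^']) * (\val x - \val x).
  apply: cvgD; first exact: cvg_cst.
  apply: cvgM; first exact: cs.
  apply: cvgB; last exact: cvg_cst.
  by apply: cvg_within_filter; exact: continuous_val.
by rewrite gE subrr mulr0 addr0.
Qed.

(** At an interior point the limit of slopes inside the interval is the usual
derivative of the extension, so the mean value theorem applies to it. *)
Lemma is_derive_clamp (g : I11 R -> R) (x : R) : -1 < x < 1 ->
  cvg (slope g (clamp x) y @[y --> (clamp x)^']) ->
  is_derive x 1 (g \o @clamp R) (derivI g (clamp x)).
Proof.
move=> x11 cs.
have ds : h^-1 *: (((g \o @clamp R) \o shift x) (h *: 1) - (g \o @clamp R) x)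
    @[h --> 0^'] --> derivI g (clamp x).
  have := @cvg_comp _ _ _ (fun h => clamp (h + x))
    (slope g (clamp x)) _ _ _ (clamp_dnbhs x11) cs; apply: cvg_trans.
  apply: near_eq_cvg.
  have d0 : 0 < Num.min (1 - x) (x + 1).
    by move: x11 => /andP[? ?]; rewrite lt_min; apply/andP; split; lra.
  rewrite /dnbhs /= near_withinE; near=> h => h0.
  have hd : `|h| < Num.min (1 - x) (x + 1).
    by near: h; exact: (@nbhs0_lt _ R).
  move: x11 hd => /andP[? ?]; rewrite lt_min.
  move=> /andP[/ltr_normlP[? ?] /ltr_normlP[? ?]].
  rewrite /= /slope !clampE; [|apply/andP; split; lra|apply/andP; split; lra].
  by rewrite addrK mulrC /GRing.scale /= mulr1.
by apply: DeriveDef; [apply: cvgP ds|exact: cvg_lim ds].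
Unshelve. all: by end_near. Qed.

Variable T : I11 R -> I11 R.
Hypothesis qT : quadratic_like T.

Lemma quadratic_like_continuous : continuous T.
Proof.
have cv : continuous (fun x : I11 R => \val (T x) : R).
  by move=> x; apply: continuous_slope; exact: ((ql_C3 qT).1 0%N).
exact: (@continuous_comp_initial _ _ _ set_val).
Qed.

Lemma ext_derivable (x : R) : -1 < x < 1 ->
  is_derive x 1 (ext T) (Dn 1 T (clamp x)).
Proof. by move=> x11; apply: is_derive_clamp => //; exact: ((ql_C3 qT).1 0%N). Qed.

Lemma ext_increasing x y : -1 <= x -> x < y -> y <= 0 -> ext T x < ext T y.
Proof.
apply: gtr0_derive1_incr => [z|z|]; rewrite ?in_itv /=; last first.
- exact/continuous_subspaceT/continuous_ext/quadratic_like_continuous.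
- move=> /andP[z1 z0]; have z11 : -1 < z < 1 by apply/andP; split; lra.
  rewrite derive1E (@derive_val _ _ _ _ _ _ _ (ext_derivable z11)).
  by apply: (ql_incr qT); rewrite clampE // !ltW //; lra.
- move=> /andP[z1 z0]; have z11 : -1 < z < 1 by apply/andP; split; lra.
  exact: (@ex_derive _ _ _ _ _ _ _ (ext_derivable z11)).
Qed.

Lemma ext_decreasing x y : 0 <= x -> x < y -> y <= 1 -> ext T y < ext T x.
Proof.
apply: ltr0_derive1_decr => [z|z|]; rewrite ?in_itv /=; last first.
- exact/continuous_subspaceT/continuous_ext/quadratic_like_continuous.
- move=> /andP[z1 z0]; have z11 : -1 < z < 1 by apply/andP; split; lra.
  rewrite derive1E (@derive_val _ _ _ _ _ _ _ (ext_derivable z11)).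
  by apply: (ql_decr qT); rewrite clampE //; apply/andP; split; lra.
- move=> /andP[z1 z0]; have z11 : -1 < z < 1 by apply/andP; split; lra.
  exact: (@ex_derive _ _ _ _ _ _ _ (ext_derivable z11)).
Qed.

Lemma quadratic_like_unimodal_return : unimodal_return (ext T) 1 (-1) 1.
Proof.
have [Tm1 T1] := ql_ends qT.
have e1 : ext T (-1) = -1 by rewrite (ext_val T (I11_m1 R)) Tm1.
have e2 : ext T 1 = -1 by rewrite (ext_val T (I11_1 R)) T1.
split => //=.
- by rewrite lexx ltrN10.
- by rewrite ltr01 lexx.
- by rewrite e1 e2.
- by move=> x _; exact: ext_itv.
- exact: ext_increasing.
- exact: ext_decreasing.
Qed.

End Quadratic.

Section Feigenbaum.
Variable R : realType.

(** The coordinate of index 0 of the jet is the map itself, so the topology of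
the space of maps is finer than that of uniform convergence. *)
Lemma nbhs_quad_maps (T : quad_maps R) (d : R) : 0 < d ->
  \forall T' \near T, forall x, `|ext (quad_fun T') x - ext (quad_fun T) x| < d.
Proof.
move=> d0.
have cj : {for T, continuous (@jet3 R)} by exact: initial_continuous.
have /cj : nbhs (jet3 T) [set g : {uniform I11 R -> 'rV[R]_4} |
    forall x : I11 R, `|g x ord0 ord0 - jet3 T x ord0 ord0| < d].
  apply/uniform_nbhs.
  exists [set uv : 'rV[R]_4 * 'rV[R]_4 | ball uv.1 d uv.2]; split.
    exact: entourage_ball (PosNum d0).
  move=> g /= gT x; have [_ /(_ ord0 ord0)] := gT x I.
  by rewrite /ball /= distrC.
move=> near_jet; apply: (@filterS _ (nbhs T) _ _ _ _ near_jet) => T' /= TT' x.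
by move: (TT' (clamp x)); rewrite /jet3 !mxE.
Qed.

Lemma Feigenbaum_no_horseshoe (T : quad_maps R) : Feigenbaum T ->
  ~ has_horseshoe (ext (quad_fun T)).
Proof.
move=> [clT _] hs.
have cT (S : quad_maps R) : continuous (quad_fun S).
  by apply: quadratic_like_continuous; exact: set_mem (valP S).
have [d d0 dT] := horseshoe_uniformly_near (continuous_ext (cT T)) hs.
have [S [S0 ST]] := clT _ (nbhs_quad_maps T d0).
have := horseshoe_ent_gt0 (cT S) (dT _ ST).
by rewrite S0 ltxx.
Qed.

Theorem Feigenbaum_mean_periodic (T : quad_maps R) (x : I11 R) :
  Feigenbaum T -> mean_periodic (ext (quad_fun T)) (\val x).
Proof.
move=> fT; have qT : quadratic_like (quad_fun T) by exact: set_mem (valP T).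
apply: unimodal_mean_periodic; last exact: val_I11.
- exact/continuous_ext/quadratic_like_continuous.
- exact: Feigenbaum_no_horseshoe.
- exact: quadratic_like_unimodal_return.
Qed.

End Feigenbaum.

(** * Averages of oscillating sequences *)

Section Cesaro.
Variable R : realType.
Implicit Types (u w : nat -> R[i]^o).

Lemma normr_normc (z : R[i]) : `|z| = (normc z)%:C%C.
Proof. by []. Qed.

Lemma normc_ge0 (z : R[i]) : 0 <= normc z.
Proof. by rewrite -lecR -normr_normc normr_ge0. Qed.

Lemma gt0_real_complex (e : R[i]) : 0 < e -> exists2 e' : R, 0 < e' & e = (e'%:C)%C.
Proof.
case: e => a b; rewrite ltcE /= => /andP[/eqP -> a0]; exists a => //.
Qed.

Lemma le_normc_sum (I : Type) (r : seq I) (P : pred I) (F : I -> R[i]) :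
  normc (\sum_(i <- r | P i) F i) <= \sum_(i <- r | P i) normc (F i).
Proof.
elim/big_rec2: _ => [|i x y _ xy]; first by rewrite normc0.
by apply: le_trans (le_normcD _ _) _; rewrite lerD2l.
Qed.

Definition cesaro0 u := forall e : R, 0 < e -> exists N0, forall N, (N0 <= N)%N ->
  normc (\sum_(1 <= n < N.+1) u n) <= e * N%:R.

Lemma normc_div_nat (z : R[i]) (N : nat) :
  normc (N%:R^-1 * z) = N%:R^-1 * normc z.
Proof.
rewrite normcM normcV; congr (_^-1 * _).
apply: (@complexI R); rewrite -normr_normc normr_nat.
by rewrite rmorph_nat.
Qed.

Lemma cesaro0P u : cesaro0 u <->
  (fun N : nat => N%:R^-1 * \sum_(1 <= n < N.+1) u n : R[i]^o) @ \oo --> (0 : R[i]^o).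
Proof.
split=> [u0|/cvgr0Pnorm_lt u0 e e0].
  apply/cvgr0Pnorm_le => _ /gt0_real_complex[e e0 ->].
  have [N0 uN0] := u0 e e0; exists N0.+1 => // N /= N0N.
  rewrite normr_normc lecR normc_div_nat ler_pdivrMl ?ltr0n; last exact: leq_trans N0N.
  by rewrite mulrC; apply: uN0; exact: ltnW.
have [|N0 _ uN0] := u0 (e%:C)%C; first by rewrite ltcR.
exists N0 => N /uN0; rewrite normr_normc ltcR normc_div_nat.
case: N => [|N]; first by rewrite big_geq ?normc0 ?mulr0.
by rewrite ltr_pdivrMl ?ltr0n // mulrC => /ltW.
Qed.

Lemma cesaro0D u w : cesaro0 u -> cesaro0 w -> cesaro0 (fun n => u n + w n).
Proof.
move=> u0 w0 e e0; have e20 : 0 < e / 2 by rewrite divr_gt0.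
have [[N1 uN1] [N2 wN2]] := (u0 _ e20, w0 _ e20).
exists (maxn N1 N2) => N; rewrite geq_max => /andP[/uN1 u1 /wN2 w2].
rewrite big_split /=; apply: le_trans (le_normcD _ _) _.
by apply: le_trans (lerD u1 w2) _; rewrite -mulrDl -splitr.
Qed.

Lemma cesaro0Z (a : R[i]) u : cesaro0 u -> cesaro0 (fun n => a * u n).
Proof.
move=> u0 e e0; have a1 : 0 < normc a + 1 by rewrite ltr_wpDl // normc_ge0.
have [|N0 uN0] := u0 (e / (normc a + 1)); first by rewrite divr_gt0.
exists N0 => N /uN0; rewrite -mulr_sumr normcM => uN.
apply: (@le_trans _ _ ((normc a + 1) * normc (\sum_(1 <= n < N.+1) u n))).
  by rewrite ler_wpM2r ?normc_ge0 // lerDl.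
by rewrite -ler_pdivlMl // mulrA [_^-1 * e]mulrC.
Qed.

Lemma cesaro0_sum (I : Type) (r : seq I) (u : I -> nat -> R[i]^o) :
  (forall i, cesaro0 (u i)) -> cesaro0 (fun n => \sum_(i <- r) u i n).
Proof.
move=> u0; elim: r => [|i r IHr].
  move=> e e0; exists 0%N => N _; rewrite big1 ?normc0; last by move=> n _; rewrite big_nil.
  by rewrite mulr_ge0 // ltW.
under eq_fun do rewrite big_cons.
exact: cesaro0D.
Qed.

Lemma expiD (a b : R) : expi (a + b) = expi a * expi b.
Proof. by rewrite /expi cosD sinD; congr (_ +i* _)%C; rewrite addrC. Qed.

Lemma expi0 : expi (0 : R) = 1.
Proof. by rewrite /expi cos0 sin0. Qed.

Lemma expiX (a : R) n : expi (a * n%:R) = expi a ^+ n.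
Proof.
elim: n => [|n IHn]; first by rewrite mulr0 expi0.
by rewrite -natr1 mulrDr mulr1 expiD IHn exprSr.
Qed.

Lemma cos_neq1 (a : R) : 0 < a < 2 * pi -> cos a != 1.
Proof.
move=> /andP[a0 a2].
have s0 : 0 < sin (a / 2) by apply: sin_gt0_pi; apply/andP; split; lra.
have -> : a = (a / 2) *+ 2 by rewrite mulr2n -splitr.
rewrite cos_mulr2n cos2sin2; apply/eqP.
have : 0 < sin (a / 2) ^+ 2 by rewrite exprn_gt0.
rewrite mulr2n; lra.
Qed.

(** The sign of the angle is the one in the definition of oscillating
sequences. *)
Definition unity_root P : R[i] := expi (- (2 * pi / P%:R)).

Lemma unity_rootX P n :
  unity_root P ^+ n = expi (- (2 * pi * n%:R / P%:R)).
Proof. by rewrite /unity_root -expiX mulNr mulrAC. Qed.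

Lemma unity_root_exp P : (0 < P)%N -> unity_root P ^+ P = 1.
Proof.
move=> P0; rewrite unity_rootX mulfK ?pnatr_eq0 -?lt0n //.
have -> : 2 * pi = pi *+ 2 :> R by rewrite mulr_natl.
by rewrite /expi cosN sinN cos2pi sin2pi oppr0.
Qed.

(** The real part of a power with [0 < n < P] is the cosine of an angle strictly
between [0] and [2 * pi], hence is not [1]. *)
Lemma unity_root_eq1 P n : (0 < P)%N -> (unity_root P ^+ n == 1) = (P %| n)%N.
Proof.
move=> P0; rewrite -(expr_mod n (unity_root_exp P0)) /dvdn.
have := ltn_mod n P; rewrite P0; case: (n %% P)%N => [|s] sP; first by rewrite expr0 !eqxx.
apply/eqP; rewrite unity_rootX => /(congr1 (@complex.Re R)) /=; rewrite cosN => /eqP.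
apply/negP/cos_neq1; rewrite !divr_gt0 ?mulr_gt0 ?pi_gt0 ?ltr0n //=.
rewrite ltr_pdivrMr ?ltr0n // ltr_pM2l ?ltr_nat //.
by rewrite mulr_gt0 // pi_gt0.
Qed.

Lemma unity_root_sum P n : (0 < P)%N ->
  \sum_(k < P) (unity_root P ^+ n) ^+ k = if (P %| n)%N then P%:R else 0.
Proof.
move=> P0; rewrite -(unity_root_eq1 n P0); set y := unity_root P ^+ n.
have [->|y1] := eqVneq y 1.
  by under eq_bigr do rewrite expr1n; rewrite sumr_const card_ord.
apply/eqP; rewrite -(mulrI_eq0 _ (lregP _ : GRing.lreg (y - 1))) ?subr_eq0 //.
by rewrite -subrX1 /y -exprM mulnC exprM unity_root_exp // expr1n subrr.
Qed.

(** By [unity_root_sum], averages of powers of the root of unity are the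
indicators of the residue classes modulo [P], and [w] is a combination of these
indicators. *)
Lemma periodic_fourier P (w : nat -> R[i]) : (0 < P)%N ->
  (forall n, w (n + P)%N = w n) -> exists a : 'I_P -> R[i],
    forall n, w n = \sum_(k < P) a k * unity_root P ^+ (k * n).
Proof.
move=> P0 wP.
exists (fun k => \sum_(r < P) w r / P%:R * unity_root P ^+ ((P - r) * k)).
move=> n; under eq_bigr do rewrite mulr_suml; rewrite exchange_big /=.
have sumE (r : 'I_P) : \sum_(k < P)
    w r / P%:R * unity_root P ^+ ((P - r) * k) * unity_root P ^+ (k * n)
    = if r == Ordinal (ltn_pmod n P0) then w r else 0.
  under eq_bigr do rewrite -mulrA [(_ * n)%N]mulnC -exprD -mulnDl exprM.
  rewrite -mulr_sumr unity_root_sum //.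
  have -> : (P %| P - r + n)%N = (r == Ordinal (ltn_pmod n P0)).
    have rP := ltn_ord r.
    rewrite addnBAC ?(ltnW rP) // -eqn_mod_dvd; last first.
      by rewrite (leq_trans (ltnW rP)) // leq_addr.
    by rewrite modnDl [(r %% P)%N]modn_small // -val_eqE eq_sym.
  by case: ifP => _; rewrite ?mulr0 // mulfVK // pnatr_eq0 -lt0n.
rewrite (eq_bigr _ (fun r _ => sumE r)) -big_mkcond big_pred1_eq /=.
by rewrite [in LHS](divn_eq n P) addnC periodicM.
Qed.

Lemma oscillating_periodic (c w : nat -> R[i]^o) P : (0 < P)%N ->
  oscillating c -> (forall n, w (n + P)%N = w n) ->
  cesaro0 (fun n => c n * w n).
Proof.
move=> P0 osc /(periodic_fourier P0)[a wE].
have P0' : 0 < P%:R :> R by rewrite ltr0n.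
have -> : (fun n => c n * w n) =
    (fun n => \sum_(k < P) a k * (c n * unity_root P ^+ (k * n))).
  apply/funext => n; rewrite wE mulr_sumr; apply: eq_bigr => k _.
  by rewrite mulrCA.
apply: cesaro0_sum => k; apply: cesaro0Z; apply/cesaro0P.
have k01 : 0 <= (k%:R / P%:R : R) < 1.
  by rewrite divr_ge0 //= ltr_pdivrMr // mul1r ltr_nat.
have := osc _ k01.
have E n : expi (- (2 * pi * n%:R * (k%:R / P%:R))) = unity_root P ^+ (k * n) :> R[i].
  by rewrite unity_rootX natrM; congr (expi (- _)); rewrite !mulrA; congr (_ / _); ring.
by under eq_fun do under eq_bigr do rewrite E.
Qed.

(** Above the level [B := D `^ (l - 1)^-1] one has [D <= x `^ (l - 1)], hence
[x <= x `^ l / D]; a large [D] makes the second term small on average. *)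
Lemma truncation (l x D : R) : 1 < l -> 0 <= x -> 0 < D ->
  x <= D `^ (l - 1)^-1 + x `^ l / D.
Proof.
move=> l1 x0 D0; have l10 : 0 < l - 1 by rewrite subr_gt0.
have [xB|Bx] := leP x (D `^ (l - 1)^-1).
  by rewrite (le_trans xB) // lerDl divr_ge0 ?powR_ge0 // ltW.
rewrite (@le_trans _ _ (x `^ l / D)) ?lerDr ?powR_ge0 //.
rewrite ler_pdivlMr // -(mulr_powRB1 x0 (lt_trans ltr01 l1)) ler_wpM2l //.
have -> : D = (D `^ (l - 1)^-1) `^ (l - 1).
  by rewrite -powRrM mulVf ?gt_eqF // powRr1 // ltW.
by rewrite ge0_ler_powR ?nnegrE ?powR_ge0 // ltW.
Qed.

Lemma growth_bound (c : nat -> R[i]^o) l : growth_condition c l ->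
  exists2 K : R, 0 < K & \forall N \near \oo,
    \sum_(1 <= n < N.+1) normc (c n) `^ l <= K * N%:R.
Proof.
move=> /eqO_exP[K [K0 bK]]; exists K => //; apply: filterS bK => N bKN.
by apply: le_trans (ler_norm _) _; rewrite normr_nat in bKN.
Qed.

(** The hypothesis says that [u] is a limit of uniformly bounded periodic
sequences for the Besicovitch seminorm.  The periodic part is handled by
[oscillating_periodic]; in the difference, [truncation] trades the mean of
[normc (u n - w n)] against the moment of [c]. *)
Lemma oscillating_cesaro0 (c u : nat -> R[i]^o) (l M : R) :
  oscillating c -> 1 < l -> growth_condition c l -> 
  (forall n, normc (u n) <= M) ->
  (forall e, 0 < e -> exists2 P, (0 < P)%N & exists (w : nat -> R[i]^o) (C : R),
    [/\ forall n, w (n + P)%N = w n, forall n, normc (w n) <= M &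
        forall N, \sum_(n < N) normc (u n - w n) <= C + e * N%:R]) ->
  cesaro0 (fun n => c n * u n).
Proof.
move=> osc l1 gr uM appr e e0.
have [K K0 [N1 _ cK]] := growth_bound gr.
have M0 : 0 <= M by apply: le_trans (uM 0%N); exact: normc_ge0.
(* with this [D], the terms [normc (c n) `^ l / D] contribute at most
   [e / 4] to the mean *)
pose D := 8 * (M + 1) * K / e.
have D0 : 0 < D by rewrite divr_gt0 ?mulr_gt0 // ltr_wpDl.
pose B := D `^ (l - 1)^-1.
have B0 : 0 < B by rewrite powR_gt0.
have [|P P0 [w [C [wP wM uw]]]] := appr (e / (8 * B)).
  by rewrite divr_gt0 // mulr_gt0.
have [|N2 cw] := oscillating_periodic P0 osc wP (e := e / 4).
  by rewrite divr_gt0.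
have [N3 N3C] : exists N3 : nat, 8 * B * (C + e / (8 * B)) / e < N3%:R.
  exists (Num.bound `|8 * B * (C + e / (8 * B)) / e|).
  by apply: le_lt_trans (ler_norm _) _; exact: archi_boundP.
exists (maxn (maxn N1 N2) N3) => N; rewrite !geq_max -andbA => /and3P[/cK cKN /cw cwN NN3].
have -> : \sum_(1 <= n < N.+1) c n * u n =
    \sum_(1 <= n < N.+1) c n * w n + \sum_(1 <= n < N.+1) c n * (u n - w n).
  by rewrite -big_split /=; apply: eq_bigr => n _; rewrite -mulrDr addrC subrK.
apply: le_trans (le_normcD _ _) _.
have d_ge0 n : 0 <= normc (u n - w n) by exact: normc_ge0.
have dM n : normc (u n - w n) <= 2 * M.
  apply: le_trans (le_normcD _ _) _; rewrite normcN.
  by have := uM n; have := wM n; lra.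
have termle n : normc (c n * (u n - w n)) <=
    B * normc (u n - w n) + 2 * M / D * normc (c n) `^ l.
  rewrite normcM; apply: (@le_trans _ _ ((B + normc (c n) `^ l / D) * normc (u n - w n))).
    by rewrite ler_wpM2r // truncation // normc_ge0.
  rewrite mulrDl lerD2l; have p0 : 0 <= normc (c n) `^ l / D.
    by rewrite divr_ge0 ?powR_ge0 // ltW.
  apply: (@le_trans _ _ (normc (c n) `^ l / D * (2 * M))).
    by rewrite ler_wpM2l.
  by rewrite le_eqVlt; apply/orP; left; apply/eqP; ring.
have d_sum : \sum_(1 <= n < N.+1) normc (u n - w n) <= C + e / (8 * B) * N.+1%:R.
  apply: le_trans (uw N.+1); rewrite -(big_mkord xpredT (fun n => normc (u n - w n))).
  by rewrite [X in _ <= X]big_ltn // lerDr.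
have err : normc (\sum_(1 <= n < N.+1) c n * (u n - w n)) <=
    B * (C + e / (8 * B) * N.+1%:R) + 2 * M / D * (K * N%:R).
  apply: le_trans (le_normc_sum _ _ _) _.
  apply: le_trans (ler_sum _ (fun n _ => termle n)) _.
  rewrite big_split /= -!mulr_sumr.
  apply: lerD; apply: ler_wpM2l => //; first exact: ltW.
  by apply: divr_ge0; [exact: mulr_ge0|exact: ltW].
have DK : 2 * M / D * K <= e / 4.
  have M10 : M + 1 != 0 by rewrite gt_eqF // ltr_wpDl.
  have -> : 2 * M / D * K = e / 4 * (M / (M + 1)).
    by rewrite /D; field; rewrite M10 !gt_eqF.
  rewrite ler_piMr //; first by rewrite divr_ge0 // ltW.
  by rewrite ler_pdivrMr ?ltr_wpDl // mul1r lerDl.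
have CB : B * (C + e / (8 * B)) <= e / 8 * N%:R.
  have : 8 * B * (C + e / (8 * B)) / e <= N%:R.
    by apply: le_trans (ltW N3C) _; rewrite ler_nat.
  rewrite ler_pdivrMr // => h.
  by rewrite -(ler_pM2l (_ : 0 < 8)) // mulrA (le_trans h) //; lra.
move: err; rewrite -[N.+1%:R]natr1; set X := normc (\sum_(1 <= n < N.+1) c n * (u n - w n)).
move=> err; apply: le_trans (lerD cwN err) _.
have BV : B * (e / (8 * B)) = e / 8 by field; rewrite gt_eqF.
have N0 : 0 <= N%:R :> R by [].
have DKN := ler_wpM2r N0 DK.
have eN : 0 <= e * N%:R by rewrite mulr_ge0 // ltW.
have -> : B * (C + e / (8 * B) * (N%:R + 1)) =
    B * (C + e / (8 * B)) + B * (e / (8 * B)) * N%:R by ring.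
rewrite BV [2 * M / D * (K * _)]mulrA; lra.
Qed.

End Cesaro.

Section Observable.
Variable R : realType.
Variable F : I11 R -> R[i]^o.
Hypothesis cF : continuous F.

Lemma continuous_normc (x : R) (e : R) : 0 < e ->
  \forall y \near x, normc (F (clamp y) - F (clamp x)) < e.
Proof.
move=> e0; have cx : (F \o @clamp R) @ x --> (F \o @clamp R) x.
  by apply: continuous_comp; [exact: continuous_clamp|exact: cF].
move/cvgrPdist_lt : cx => /(_ (e%:C)%C); rewrite ltcR => /(_ e0).
apply: filterS => y /=; rewrite normr_normc ltcR.
by rewrite -normcN opprB.
Qed.

Lemma clamp_dist (x y : R) : `|\val (clamp x) - \val (clamp y)| <= `|x - y|.
Proof.
wlog xy : x y / x <= y => [hw|].
  by have [/hw //|/ltW/hw] := leP x y; rewrite distrC (distrC x).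
rewrite distrC (distrC x) /= [X in _ <= X]ger0_norm ?subr_ge0 //.
rewrite ler_norml; case: (lerP 1 x) => ?; case: (lerP 1 y) => ?;
  case: (lerP (-1) x) => ?; case: (lerP (-1) y) => ?; case: (lerP (-1) (1 : R)) => ?;
  by apply/andP; split; lra.
Qed.

Lemma observable_bounded : exists M : R, forall x, normc (F x) <= M.
Proof.
have /compact_near_coveringP cpt := @segment_compact R (-1) 1.
have := @cpt R (pinfty_nbhs R) (fun M x => normc (F (clamp x)) <= M) _ _.
case=> [x _|M [_ /(_ (M + 1))]].
  exists ([set y | normc (F (clamp y) - F (clamp x)) < 1],
          [set M | normc (F (clamp x)) + 1 <= M]); first split.
  - exact: continuous_normc.
  - exact: nbhs_pinfty_ge (num_real _).
  case=> y M [/= yx xM]; apply: le_trans xM.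
  rewrite -[F (clamp y)](subrK (F (clamp x))) addrC.
  by apply: le_trans (le_normcD _ _) _; rewrite lerD2l ltW.
rewrite ltrDl => /(_ ltr01) FM; exists (M + 1) => x.
rewrite -(clampK x); apply: FM; rewrite /= in_itv /=; exact: val_I11.
Qed.

Lemma observable_uniform (e : R) : 0 < e -> exists2 d : R, 0 < d &
  forall x y : R, `|x - y| < d -> normc (F (clamp x) - F (clamp y)) <= e.
Proof.
move=> e0; have e20 : 0 < e / 2 by rewrite divr_gt0.
have /compact_near_coveringP cpt := @segment_compact R (-1) 1.
have near_d : \forall d \near (0 : R)^'+, `[-1, 1] `<=` [set x : R |
    forall y, `|x - y| < d -> normc (F (clamp x) - F (clamp y)) <= e].
  apply: cpt => x _.
  have /nbhs_ballP[r /= r0 xr] := continuous_normc x e20.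
  exists (ball x (r / 2), [set d | d < r / 2]); first split => /=.
  - by apply: nbhsx_ballx; rewrite divr_gt0.
  - by apply: nbhs_right_lt; rewrite divr_gt0.
  case=> z d /= [xz dr] y zy; rewrite /ball /= in xz.
  have xz' : normc (F (clamp z) - F (clamp x)) < e / 2.
    by apply: xr; rewrite /ball /=; lra.
  have xy' : normc (F (clamp y) - F (clamp x)) < e / 2.
    apply: xr; rewrite /ball /= -(subrK z x) -addrA.
    by apply: le_lt_trans (ler_normD _ _) _; lra.
  rewrite -(subrK (F (clamp x)) (F (clamp z))) -addrA.
  apply: le_trans (le_normcD _ _) _; rewrite -normcN opprB in xy'; lra.
have [d [dP d0]] : exists d : R, (`[-1, 1] `<=` [set x : R |
    forall y, `|x - y| < d -> normc (F (clamp x) - F (clamp y)) <= e]) /\ 0 < d.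
  by apply: (@filter_ex _ (0 : R)^'+); apply: filterI => //; exact: nbhs_right_gt.
exists d => // x y xy.
have x11 : I11 R (\val (clamp x)) by exact: set_mem (valP (clamp x)).
have := dP _ x11 (\val (clamp y)) (le_lt_trans (clamp_dist x y) xy).
by rewrite !clampK.
Qed.

(** Beyond the scale [d] of uniform continuity, the oscillation [2 M] is
dominated by [2 M / d] times the distance; this affine bound can be averaged
along an orbit. *)
Lemma observable_modulus (e : R) : 0 < e -> exists2 K : R, 0 <= K &
  forall x y : R, normc (F (clamp x) - F (clamp y)) <= e + K * `|x - y|.
Proof.
move=> e0; have [M FM] := observable_bounded.
have [d d0 Fd] := observable_uniform e0.
have M0 : 0 <= M by apply: le_trans (FM (clamp 0)); exact: normc_ge0.
have K0 : 0 <= 2 * M / d by rewrite divr_ge0 ?mulr_ge0 // ltW.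
exists (2 * M / d) => // x y.
have [xyd|dxy] := ltP `|x - y| d.
  by apply: le_trans (Fd _ _ xyd) _; rewrite lerDl mulr_ge0.
apply: (@le_trans _ _ (2 * M)).
  apply: le_trans (le_normcD _ _) _; rewrite normcN.
  by have := FM (clamp x); have := FM (clamp y); lra.
apply: (@le_trans _ _ (2 * M / d * `|x - y|)); last by rewrite lerDr ltW.
by rewrite -[X in X <= _](@divfK _ d) ?gt_eqF // ler_wpM2l.
Qed.

End Observable.

(** [observable_modulus] turns periodicity in the mean of the orbit into that of
the observable along it; the periodic approximation may leave the interval and
is projected back by [clamp], which does not increase distances. *)
Theorem mean_periodic_disjoint (R : realType) (c : nat -> R[i]^o) (lambda : R)
    (T : I11 R -> I11 R) :
  oscillating c -> 1 < lambda -> growth_condition c lambda ->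
  (forall x : I11 R, mean_periodic (ext T) (\val x)) ->
  linearly_disjoint c T.
Proof.
move=> osc l1 gr mpT F cF x; apply/cesaro0P.
have [M FM] := observable_bounded cF.
apply: (@oscillating_cesaro0 _ c (fun n => F (iter n T x)) lambda M) => // e e0.
have e20 : 0 < e / 2 by rewrite divr_gt0.
have [K K0 FK] := observable_modulus cF e20.
have [|P P0 [w [C [wP wC]]]] := mpT x (e / (2 * (K + 1))).
  by rewrite divr_gt0 // mulr_gt0 // ltr_wpDl.
exists P => //; exists (fun n => F (clamp (w n))), (K * C); split => [n|n|N].
- by rewrite wP.
- exact: FM.
apply: (@le_trans _ _ (\sum_(n < N) (e / 2 + K * `|iter n (ext T) (\val x) - w n|))).
  by apply: ler_sum => n _; rewrite -(clampK (iter n T x)) -iter_ext.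
rewrite big_split /= sumr_const card_ord -mulr_sumr -mulr_natr.
have := ler_wpM2l K0 (wC N).
have K1 : K + 1 != 0 by rewrite gt_eqF // ltr_wpDl.
have : K * (e / (2 * (K + 1)) * N%:R) <= e / 2 * N%:R.
  have -> : K * (e / (2 * (K + 1)) * N%:R) = e / 2 * N%:R * (K / (K + 1)) by field.
  rewrite ler_piMr // ?mulr_ge0 // ?ltW //.
  by rewrite ltr_pdivrMr ?ltr_wpDl // mul1r ltrDl.
rewrite mulrDr; lra.
Qed.

Theorem corollary10 (R : realType) (c : nat -> R[i]^o) (lambda : R)
    (c_osc : oscillating c)
    (lambda_gt1 : 1 < lambda)
    (c_growth : growth_condition c lambda)
    (T : quad_maps R) (T_Feigenbaum : Feigenbaum T) :
  linearly_disjoint c (quad_fun T).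
Proof.
apply: (mean_periodic_disjoint c_osc lambda_gt1 c_growth) => x.
exact: Feigenbaum_mean_periodic.
Qed.
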